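(* For every $n\in\mathbb{N}$, $n\ge 1$, the pair $(A,L)$ is a biautomatic structure for the Chinese monoid $C_n$ of rank $n$.
   Context: Let $A=\{1<2<\dots<n\}$. The Chinese monoid of rank $n$, denoted $C_n$, is the monoid presented by $\langle A\mid \mathcal{R}\rangle$ with $\mathcal{R}=\{(zyx,zxy),(zxy,yzx): x\le y\le z\}$, $x,y,z\in A$. Let $D=\{d_{\alpha\beta}:\alpha,\beta\in A,\ \alpha>\beta\}\cup\{d_\alpha:\alpha\in A\}$ be a set of new symbols. Let $K^{(k)}=d_{k1}^*d_{k2}^*\cdots d_{k(k-1)}^*d_k^*\subseteq D^*$ and $K=K^{(1)}K^{(2)}\cdots K^{(n)}$. Let $\mathcal{Q}\subseteq D^*\times A^*$ be the relation $\{(d_{\alpha\beta},\alpha\beta),(d_\alpha,\alpha):\alpha,\beta\in A,\alpha>\beta\}^*$ (so $\mathcal{Q}$ is the map that reads off subscripts). Let $L=\{u\in A^*:(\exists u'\in K)\,(u',u)\in\mathcal{Q}\}$. (Equivalently, $L$ is the set of words $\ell^{(1)}\cdots\ell^{(n)}$ with $\ell^{(k)}=(k1)^{\sigma_{k1}}(k2)^{\sigma_{k2}}\cdots(k(k-1))^{\sigma_{k(k-1)}}k^{\sigma_k}$, where $(kj)$ is the two-letter word with letters $k$ and $j$ and all exponents are non-negative integers.) Biautomatic structures: let $\$$ be a symbol not in $A$. For $u=u_1\cdots u_m$ and $v=v_1\cdots v_p$ in $A^*$, $\delta_{\mathrm{R}}(u,v)$ is the word over the alphabet $(A\cup\{\$\})\times(A\cup\{\$\})$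 obtained by padding the shorter of $u,v$ on the right with symbols $\$$ until the lengths agree and then pairing letters position by position; $\delta_{\mathrm{L}}(u,v)$ is defined in the same way but padding the shorter word on the left. For a relation $R\subseteq A^*\times A^*$, $R\delta_{\mathrm{R}}$ and $R\delta_{\mathrm{L}}$ denote the images of $R$. Let $M$ be a monoid, $A$ a finite alphabet representing a set of generators for $M$, and $L\subseteq A^*$ a regular language such that every element of $M$ has at least one representative in $L$. For $a\in A\cup\{\varepsilon\}$ ($\varepsilon$ the empty word) let $L_a=\{(u,v):u,v\in L,\ ua=_M v\}$ and ${}_aL=\{(u,v):u,v\in L,\ au=_M v\}$, where $=_M$ means representing the same element of $M$. The pair $(A,L)$ is a biautomatic structure for $M$ if $L_a\delta_{\mathrm{R}}$, ${}_aL\delta_{\mathrm{R}}$, $L_a\delta_{\mathrm{L}}$ and ${}_aL\delta_{\mathrm{L}}$ are regular languages over $(A\cup\{\$\})\times(A\cup\{\$\})$ for all $a\in A\cup\{\varepsilon\}$. *)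

(* Defs.v *)
From HB Require Import structures.
From mathcomp Require Import all_boot.
From mathcomp Require Import boolp classical_sets.

Set Implicit Arguments.
Unset Strict Implicit.
Unset Printing Implicit Defensive.

Import Algebra.

Local Open Scope classical_set_scope.
Local Open Scope quotient_scope.

Record dfa (S : finType) := Dfa {
  dfa_state : finType;
  dfa_init : dfa_state;
  dfa_step : dfa_state -> S -> dfa_state;
  dfa_final : {set dfa_state} }.

Definition dfa_lang (S : finType) (M : dfa S) : set (seq S) :=
  [set w | foldl (@dfa_step S M) (dfa_init M) w \in dfa_final M].

Definition regular (S : finType) (X : set (seq S)) : Prop :=
  exists M : dfa S, dfa_lang M = X.

Definition lang_eps (S : Type) : set (seq S) := [set [::]].

Definition lang_cat (S : Type) (X Y : set (seq S)) : set (seq S) :=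
  [set u ++ v | u in X & v in Y].

(* The language x^* for a single letter x. *)
Definition lang_powers (S : Type) (x : S) : set (seq S) :=
  range (fun m => nseq m x).

(* The padding symbol $ is None : option A. *)
Definition deltaR (A : Type) (p : seq A * seq A) :
    seq (option A * option A) :=
  let: (u, v) := p in
  zip (map Some u ++ nseq (size v - size u) None)
      (map Some v ++ nseq (size u - size v) None).

Definition deltaL (A : Type) (p : seq A * seq A) :
    seq (option A * option A) :=
  let: (u, v) := p in
  zip (nseq (size v - size u) None ++ map Some u)
      (nseq (size u - size v) None ++ map Some v).

Section Biautomatic.

Context (M : monoidType) (A : finType) (rep : A -> M) (L : set (seq A)).

Definition word_eval (w : seq A) : M := (\prod_(x <- w) rep x)%g.

(* An element a of A ∪ {ε} is encoded in option A, with None standing for ε;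
   seq_of_opt a is the corresponding word of length at most one. *)
Definition right_mul_rel (a : option A) : set (seq A * seq A) :=
  [set p | [/\ L p.1, L p.2 &
               word_eval (p.1 ++ seq_of_opt a) = word_eval p.2]].

Definition left_mul_rel (a : option A) : set (seq A * seq A) :=
  [set p | [/\ L p.1, L p.2 &
               word_eval (seq_of_opt a ++ p.1) = word_eval p.2]].

Record biautomatic_structure : Prop := BiautomaticStructure {
  biauto_gen : forall m : M, exists w : seq A, word_eval w = m;
  biauto_regular : regular L;
  biauto_onto : forall m : M, exists2 w : seq A, L w & word_eval w = m;
  biauto_rightR : forall a, regular ((@deltaR A) @` right_mul_rel a);
  biauto_leftR : forall a, regular ((@deltaR A) @` left_mul_rel a);
  biauto_rightL : forall a, regular ((@deltaL A) @` right_mul_rel a);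
  biauto_leftL : forall a, regular ((@deltaL A) @` left_mul_rel a) }.

End Biautomatic.

Section Presentation.

Context (A : choiceType) (R : seq A -> seq A -> Prop).

Inductive presentation_cong : seq A -> seq A -> Prop :=
| cong_rel p s u v :
    R u v -> presentation_cong (p ++ u ++ s) (p ++ v ++ s)
| cong_refl u : presentation_cong u u
| cong_sym u v : presentation_cong u v -> presentation_cong v u
| cong_trans u v w :
    presentation_cong u v -> presentation_cong v w -> presentation_cong u w.

Definition presentation_eqv : rel (seq A) :=
  fun u v => `[< presentation_cong u v >].

Lemma presentation_eqv_refl : reflexive presentation_eqv.
Proof. by move=> u; apply/asboolP/cong_refl. Qed.

Lemma presentation_eqv_sym : symmetric presentation_eqv.
Proof. by move=> u v; apply/asboolP/asboolP => /cong_sym. Qed.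

Lemma presentation_eqv_trans : transitive presentation_eqv.
Proof.
by move=> v u w /asboolP uv /asboolP vw; apply/asboolP/(cong_trans uv).
Qed.

Canonical presentation_equiv :=
  EquivRel presentation_eqv
    presentation_eqv_refl presentation_eqv_sym presentation_eqv_trans.

Definition presented_monoid := {eq_quot presentation_equiv}.

HB.instance Definition _ := Choice.on presented_monoid.
HB.instance Definition _ := EqQuotient.on presented_monoid.

Lemma pi_presentedP (u v : seq A) :
  reflect (presentation_cong u v) ((\pi u : presented_monoid) == \pi v).
Proof. by rewrite piE; apply: asboolP. Qed.

Lemma presentation_cong_cat u u' v v' :
  presentation_cong u u' -> presentation_cong v v' ->
  presentation_cong (u ++ v) (u' ++ v').
Proof.
move=> cu cv; apply: (@cong_trans _ (u' ++ v)).
  elim: cu => {u u'} [p s u u' Ru|u|u u' _|u w u' _ cuw _]; last 1 first.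
  - exact: cong_trans.
  - by rewrite -!catA; apply: cong_rel.
  - exact: cong_refl.
  - exact: cong_sym.
elim: cv => {v v'} [p s v v' Rv|v|v v' _|v w v' _ cvw _]; last 1 first.
- exact: cong_trans.
- by rewrite !(catA u'); apply: cong_rel.
- exact: cong_refl.
- exact: cong_sym.
Qed.

Definition presented_one : presented_monoid := \pi_presented_monoid [::].

Definition presented_mul (x y : presented_monoid) : presented_monoid :=
  \pi_presented_monoid (repr x ++ repr y).

Lemma presented_mul_pi u v :
  presented_mul (\pi u) (\pi v) = \pi_presented_monoid (u ++ v).
Proof.
apply/eqP/pi_presentedP; apply: presentation_cong_cat;
  by apply/pi_presentedP; rewrite reprK.
Qed.

Lemma presented_mulA : associative presented_mul.
Proof.
move=> x y z; rewrite -[x]reprK -[y]reprK -[z]reprK.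
by rewrite !presented_mul_pi catA.
Qed.

Lemma presented_mul1 : left_id presented_one presented_mul.
Proof. by move=> x; rewrite -[x]reprK presented_mul_pi. Qed.

Lemma presented_mulr1 : right_id presented_one presented_mul.
Proof. by move=> x; rewrite -[x]reprK presented_mul_pi cats0. Qed.

HB.instance Definition _ := isMonoid.Build presented_monoid
  presented_mulA presented_mul1 presented_mulr1.

Definition presented_gen (a : A) : presented_monoid :=
  \pi_presented_monoid [:: a].

Lemma prod_presented_gen (w : seq A) :
  (\prod_(x <- w) presented_gen x)%g = \pi_presented_monoid w.
Proof.
elim: w => [|a w IH]; first by rewrite big_nil.
by rewrite big_cons IH; apply: presented_mul_pi.
Qed.

End Presentation.

(* The alphabet {1 < ... < n} is 'I_n = {0 < ... < n - 1} with its usual order. *)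
Inductive chinese_rel (n : nat) : seq 'I_n -> seq 'I_n -> Prop :=
| chinese_rel1 (x y z : 'I_n) : x <= y -> y <= z ->
    chinese_rel [:: z; y; x] [:: z; x; y]
| chinese_rel2 (x y z : 'I_n) : x <= y -> y <= z ->
    chinese_rel [:: z; x; y] [:: y; z; x].

Definition chinese_monoid (n : nat) : monoidType :=
  presented_monoid (@chinese_rel n).

Definition chinese_gen (n : nat) (a : 'I_n) : chinese_monoid n :=
  presented_gen (@chinese_rel n) a.

(* d_pair k j stands for d_{kj}; the constraint k > j is carried by the type
   'I_k of j. *)
Inductive dsym (n : nat) : Type :=
| d_pair (k : 'I_n) (j : 'I_k)
| d_single (k : 'I_n).

Definition subscripts (n : nat) (d : dsym n) : seq 'I_n :=
  match d with
  | d_pair k j => [:: k; widen_ord (ltnW (ltn_ord k)) j]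
  | d_single k => [:: k]
  end.

(* The submonoid of D^* x A^* generated by the pairs (d, subscripts d). *)
Inductive readoff (n : nat) : seq (dsym n) -> seq 'I_n -> Prop :=
| readoff_nil : readoff [::] [::]
| readoff_cons d u' u :
    readoff u' u -> readoff (d :: u') (subscripts d ++ u).

Definition chinese_Kblock (n : nat) (k : 'I_n) : set (seq (dsym n)) :=
  lang_cat (\big[@lang_cat (dsym n)/@lang_eps (dsym n)]_(j < k)
              lang_powers (@d_pair n k j))
           (lang_powers (d_single k)).

Definition chinese_K (n : nat) : set (seq (dsym n)) :=
  \big[@lang_cat (dsym n)/@lang_eps (dsym n)]_(k < n) chinese_Kblock k.

Definition chinese_lang (n : nat) : set (seq 'I_n) :=
  [set u | exists2 u', chinese_K u' & readoff u' u].

(* Main.v *)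
Require Import Defs.
From mathcomp Require Import all_boot.
From mathcomp Require Import zify boolp classical_sets.

(** Call _cells_ the words d_kj = kj (j < k) and d_k = k.  A word of L is a
    sorted product of cells, so it is determined by the finitely many
    multiplicities of its cells.  The theorem holds for three reasons.

    Multiplying a normal form by a letter, on either side, changes these
    multiplicities by a bounded amount that depends only on which of them
    vanish ([right_mul_update], [left_mul_update]).  Indeed the cell kj commutes
    with every letter between j and k.  A letter entering on the right travels
    down the rows: in row k it is absorbed, or passes through, or trades places
    with the largest column of the row, which then travels on.  A letter a
    entering on the left travels up to row a: the first nonempty row below a
    turns it into a cell aj, whose column j is then exchanged with the smallest
    column of a row whenever that one is smaller.

    Normal forms are unique ([normal_form_unique]).  For s <= t, read every
    letter >= t as an opening bracket and every letter < s as a closing one.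
    The number of unmatched opening brackets is an invariant of the Chinese
    monoid (the map factors through the bicyclic monoid).  On a normal form it
    counts the letters >= t minus the cells with row >= t and column < s;
    inclusion-exclusion recovers the multiplicities of the cells kj with j < k,
    and the numbers of letters, which are invariant too, give the others.

    Consequently each relation to be recognised consists of the pairs of words
    of L whose multiplicities differ by a vector that is a function of the
    support of the first word.  Since the vector is bounded, so is the
    difference of the multiplicities accumulated in the two components at any
    point of a padded pair ([count_lag]).  A finite automaton can therefore
    maintain it ([update_regular]), for padding on the right and on the left
    alike. *)

Set Implicit Arguments.
Unset Strict Implicit.
Unset Printing Implicit Defensive.

Import Algebra.

Local Open Scope classical_set_scope.

(** * Cells and their order *)

(** The cell (k, j) with j < k is the symbol d_kj, and (k, k) is d_k; so the
    cells of K in the order in which its blocks are listed are ordered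
    lexicographically. *)
Notation cell n := ('I_n * 'I_n)%type.

Definition cell_word n (t : cell n) : seq 'I_n :=
  if t.2 == t.1 then [:: t.1] else [:: t.1; t.2].

Definition cells_word n (c : seq (cell n)) : seq 'I_n :=
  flatten [seq cell_word t | t <- c].

Definition cell_le n : rel (cell n) :=
  fun t t' => (t.1 < t'.1) || (t.1 == t'.1) && (t.2 <= t'.2).

Definition cell_valid n : pred (cell n) := fun t => t.2 <= t.1.

Definition in_row n (k : 'I_n) : pred (cell n) :=
  fun t => (t.1 == k) && cell_valid t.

Definition below n (k : nat) : pred (cell n) :=
  fun t => (t.1 < k) && cell_valid t.

Definition above n (k : nat) : pred (cell n) :=
  fun t => (k <= t.1) && cell_valid t.

Lemma cell_le_refl n : reflexive (@cell_le n).
Proof. by move=> t; rewrite /cell_le eqxx leqnn orbT. Qed.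

Lemma cell_le_trans n : transitive (@cell_le n).
Proof. by move=> [a b] [c d] [e f]; rewrite /cell_le /= -!val_eqE /=; lia. Qed.

Lemma cell_le_total n : total (@cell_le n).
Proof. by move=> [a b] [c d]; rewrite /cell_le /= -!val_eqE /=; lia. Qed.

Lemma cell_le_anti n : antisymmetric (@cell_le n).
Proof.
move=> [a b] [c d]; rewrite /cell_le /= -!val_eqE /= => h.
by congr (_, _); apply: val_inj; move: h => /=; lia.
Qed.

Lemma cell_sort_sorted n (c : seq (cell n)) :
  sorted (@cell_le n) (sort (@cell_le n) c).
Proof. exact/sort_sorted/cell_le_total. Qed.

Lemma cell_sort_perm n (c c' : seq (cell n)) :
  perm_eq c c' -> sort (@cell_le n) c = sort (@cell_le n) c'.
Proof.
move/perm_sortP; apply;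
  [exact: cell_le_total|exact: cell_le_trans|exact: cell_le_anti].
Qed.

(** * Multiplying a normal form by a letter *)

Lemma perm_prodg_commute (M : monoidType) (I : eqType) (F : I -> M) s s' :
  {in s &, forall i j, commute (F i) (F j)} -> perm_eq s s' ->
  (\prod_(i <- s) F i = \prod_(i <- s') F i)%g.
Proof.
elim: s s' => [|x s IHs] s' comF; first by rewrite perm_sym => /perm_nilP->.
move=> pxs; have xs' : x \in s' by rewrite -(perm_mem pxs) mem_head.
have subs : {subset s' <= x :: s} by move=> y; rewrite (perm_mem pxs).
case/splitPr: s' / xs' pxs subs => a b pxs subs.
rewrite big_cons big_cat big_cons /= (IHs (a ++ b)); last 2 first.
- by move=> i j si sj; apply: comF; rewrite inE ?si ?sj orbT.
- by move: pxs; rewrite perm_sym -cat1s perm_catCA cat1s perm_cons perm_sym.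
rewrite big_cat /= !mulgA; congr (_ * _)%g.
rewrite big_seq_cond; apply: commute_prod => i /andP[ai _].
by apply: comF; rewrite ?mem_head // subs // mem_cat ai.
Qed.

Section ChineseRelations.

Context (n : nat) (M : monoidType) (g : 'I_n -> M).
Context (g_zyx : forall x y z : 'I_n, x <= y -> y <= z ->
  (g z * g y * g x = g z * g x * g y)%g).
Context (g_zxy : forall x y z : 'I_n, x <= y -> y <= z ->
  (g z * g x * g y = g y * g z * g x)%g).

Local Open Scope group_scope.

Definition cell_eval (t : cell n) : M :=
  if t.2 == t.1 then g t.1 else g t.1 * g t.2.

(** Sorting first makes the value depend on the multiset [c] only, so that
    normal forms can be handled up to permutation. *)
Definition cells_eval (c : seq (cell n)) : M :=
  \prod_(t <- sort (@cell_le n) c) cell_eval t.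

Lemma prod_cells_word c :
  \prod_(x <- cells_word c) g x = \prod_(t <- c) cell_eval t.
Proof.
rewrite /cells_word; elim: c => [|t c IHc]; first by rewrite !big_nil.
rewrite /= big_cat /= IHc big_cons; congr (_ * _).
by rewrite /cell_word /cell_eval; case: ifP; rewrite !big_cons big_nil mulg1.
Qed.

(** For j < k this is the relation zxy = yzx with z = k, x = j. *)
Lemma cell_commute_gen (k j y : 'I_n) : j <= y -> y <= k ->
  commute (cell_eval (k, j)) (g y).
Proof.
move=> jy yk; rewrite /commute /cell_eval /=; case: eqP => [jk|_].
  suff -> : y = k by [].
  by apply: val_inj; rewrite jk in jy; apply/eqP; rewrite eqn_leq jy yk.
by rewrite mulgA; apply: g_zxy.
Qed.

Lemma cell_commute_nested (k j k' j' : 'I_n) : j <= j' -> j' <= k' -> k' <= k ->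
  commute (cell_eval (k, j)) (cell_eval (k', j')).
Proof.
move=> jj' jk' k'k; rewrite {2}/cell_eval /=; case: eqP => [_|_].
  by apply: cell_commute_gen; lia.
by apply: commuteM; apply: cell_commute_gen; lia.
Qed.

Lemma row_commute (k : 'I_n) (r : seq (cell n)) : all (in_row k) r ->
  {in r &, forall t t', commute (cell_eval t) (cell_eval t')}.
Proof.
move/allP => rk [k1 j] [k2 j'] /rk/andP[/= /eqP-> h] /rk/andP[/= /eqP-> h'].
rewrite /cell_valid /= in h h'.
case: (leqP j j') => jj'; first exact: cell_commute_nested.
by apply/commute_sym/cell_commute_nested => //; exact: ltnW.
Qed.

Lemma cells_eval_perm c c' : perm_eq c c' -> cells_eval c = cells_eval c'.
Proof. by move=> pcc'; rewrite /cells_eval (cell_sort_perm pcc'). Qed.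

Lemma cells_eval_cat c c' :
  {in c & c', forall t t', cell_le t t'} ->
  cells_eval (c ++ c') = cells_eval c * cells_eval c'.
Proof.
move=> cc'; rewrite /cells_eval -big_cat; congr bigop.
apply: (sorted_eq (@cell_le_trans n) (@cell_le_anti n)).
- exact: cell_sort_sorted.
- rewrite sorted_pairwise ?pairwise_cat; last exact: cell_le_trans.
  rewrite -!sorted_pairwise ?cell_sort_sorted ?andbT; try exact: cell_le_trans.
  by apply/allrelP => t t'; rewrite !mem_sort; apply: cc'.
- by rewrite perm_sort perm_cat // perm_sym perm_sort.
Qed.

Lemma cells_eval_row (k : 'I_n) r : all (in_row k) r ->
  cells_eval r = \prod_(t <- r) cell_eval t.
Proof.
move=> rk; rewrite /cells_eval.
rewrite (perm_prodg_commute (s := r) _ (s' := sort (@cell_le n) r)) //.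
  exact: row_commute rk.
by rewrite perm_sym perm_sort.
Qed.

Lemma cells_eval_top_row (k : 'I_n) c r : all (below k) c -> all (in_row k) r ->
  cells_eval (c ++ r) = cells_eval c * \prod_(t <- r) cell_eval t.
Proof.
move=> /allP ck rk; rewrite cells_eval_cat ?(cells_eval_row rk) // => t t'.
move=> /ck/andP[tk _] t'r; have /allP/(_ _ t'r)/andP[/eqP e _] := rk.
by rewrite /cell_le e tk.
Qed.

Lemma cells_eval_bottom_row (k : 'I_n) c r :
  all (in_row k) r -> all (above k.+1) c ->
  cells_eval (r ++ c) = \prod_(t <- r) cell_eval t * cells_eval c.
Proof.
move=> rk /allP ck; rewrite cells_eval_cat ?(cells_eval_row rk) // => t t'.
move=> tr /ck/andP[t'k _]; have /allP/(_ _ tr)/andP[/eqP e _] := rk.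
by rewrite /cell_le e t'k.
Qed.

Lemma perm_row_rem (k j : 'I_n) r : all (in_row k) r -> (k, j) \in r ->
  exists r', [/\ perm_eq r ((k, j) :: r'), j <= k, all (in_row k) r',
    \prod_(t <- r) cell_eval t = cell_eval (k, j) * \prod_(t <- r') cell_eval t
  & \prod_(t <- r) cell_eval t = \prod_(t <- r') cell_eval t * cell_eval (k, j)].
Proof.
move=> rk kjr; exists (rem (k, j) r); have pr := perm_to_rem kjr.
have pr' : perm_eq r (rem (k, j) r ++ [:: (k, j)]).
  by apply: perm_trans pr _; rewrite -cat1s perm_catC.
have := rk; rewrite (perm_all _ pr) /= => /andP[/andP[_ jk] rk'].
split=> //.
  by rewrite (perm_prodg_commute (row_commute rk) pr) big_cons.
by rewrite (perm_prodg_commute (row_commute rk) pr') big_cat big_seq1.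
Qed.

Lemma row_commute_prod (k : 'I_n) r m : all (in_row k) r ->
  (forall j : 'I_n, (k, j) \in r -> j <= k -> commute m (cell_eval (k, j))) ->
  commute m (\prod_(t <- r) cell_eval t).
Proof.
move=> /allP rk mr; rewrite big_seq_cond; apply: commute_prod => -[k1 j].
move=> /andP[tr _]; have /andP[/= /eqP e jk] := rk _ tr.
by rewrite e in tr jk *; apply: mr.
Qed.

(** [F] acts on the normal forms with cells in [P] by adding and deleting
    cells in a way that depends only on the support [S] of the normal form;
    since there are finitely many supports, the change is bounded. *)
Definition bounded_update (P : pred (cell n)) (F : M -> M) : Prop :=
  forall S : {set cell n}, exists add del : seq (cell n),
  forall c, all P c -> [set t in c] = S ->
  exists c', [/\ all P c', perm_eq (c' ++ del) (c ++ add)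
               & F (cells_eval c) = cells_eval c'].


Definition row (k : 'I_n) (c : seq (cell n)) := [seq t <- c | t.1 == k].
Definition other_rows (k : 'I_n) (c : seq (cell n)) := [seq t <- c | t.1 != k].

Lemma perm_rows k c : perm_eq c (other_rows k c ++ row k c).
Proof. by rewrite perm_sym perm_catC /other_rows /row perm_filterC. Qed.

Lemma count_rows k c p : count p c = count p (other_rows k c) + count p (row k c).
Proof. by move/permP: (perm_rows k c) => ->; rewrite count_cat. Qed.

Lemma mem_row k j c : ((k, j) \in row k c) = ((k, j) \in c).
Proof. by rewrite mem_filter /= eqxx. Qed.

Lemma all_row_valid (k : 'I_n) c :
  all (@cell_valid n) c -> all (in_row k) (row k c).
Proof.
move/allP => vc; apply/allP => t; rewrite mem_filter => /andP[tk /vc].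
by rewrite /in_row tk.
Qed.

Lemma set_other_rows k c :
  [set t in other_rows k c] = [set t in [set t in c] | t.1 != k].
Proof. by apply/setP => t; rewrite !inE mem_filter andbC. Qed.

(** Induction on the number of rows, from the top one down.  What leaves row [k]
    to the left is a letter smaller than [k], to which the induction applies.
    Later steps do not look at row [k] again, hence they see the support of the
    remaining rows unchanged. *)
Lemma right_update K (x : 'I_n) : K <= n -> x < K ->
  bounded_update (below K) (fun m => m * g x).
Proof.
elim: K x => // K IHK x Kn xK S; pose k := Ordinal Kn.
have c0P c : all (below K.+1) c -> all (below k) (other_rows k c).
  move=> /allP cK; apply/allP => t; rewrite mem_filter -val_eqE /below /=.
  by move=> /andP[tk /cK/andP[tK ->]]; rewrite andbT /=; lia.
have rP c : all (below K.+1) c -> all (in_row k) (row k c).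
  by move=> /allP cK; apply/all_row_valid/allP => t /cK/andP[].
have catP c r : all (below k) c -> all (in_row k) r -> all (below K.+1) (c ++ r).
  move=> /allP cK /allP rk; apply/allP => t; rewrite mem_cat /below.
  case/orP => [/cK/andP[tK ->]|/rk/andP[/eqP tk ->]]; last by rewrite tk andbT ltnSn.
  by rewrite andbT leqW.
have splitE c : all (below K.+1) c -> cells_eval c =
    cells_eval (other_rows k c) * \prod_(t <- row k c) cell_eval t.
  move=> cK; rewrite (cells_eval_perm (perm_rows k c)).
  by rewrite (cells_eval_top_row (c0P _ cK) (rP _ cK)).
(* The letter k is absorbed as a cell (k, k). *)
have [xk|xk] := eqVneq x k.
  exists [:: (k, k)], [::] => c cK _.
  exists (other_rows k c ++ rcons (row k c) (k, k)).
  have r'P : all (in_row k) (rcons (row k c) (k, k)).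
    by rewrite all_rcons rP // /in_row eqxx /cell_valid /= leqnn.
  split; first exact: catP (c0P _ cK) r'P.
    by rewrite cats0 -cats1 catA perm_cat2r perm_sym perm_rows.
  rewrite (cells_eval_top_row (c0P _ cK) r'P) splitE // -cats1 big_cat big_seq1.
  by rewrite {3}/cell_eval eqxx xk mulgA.
have {}xK : x < K by move: xk; rewrite -val_eqE /=; lia.
(* A cell (k, k) absorbs x and becomes (k, x). *)
have [kkS|kkS] := boolP ((k, k) \in S).
  exists [:: (k, x)], [:: (k, k)] => c cK cS.
  have kkr : (k, k) \in row k c by rewrite mem_row -cS inE in kkS *.
  have [r [pr _ rP' _ Er]] := perm_row_rem (rP _ cK) kkr.
  have r'P : all (in_row k) (rcons r (k, x)).
    by rewrite all_rcons rP' /in_row eqxx /cell_valid /= ltnW.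
  exists (other_rows k c ++ rcons r (k, x)); split.
  - exact: catP (c0P _ cK) r'P.
  - apply/permP => p; rewrite -cats1 !count_cat (count_rows k c) (permP pr) /=.
    lia.
  - rewrite (cells_eval_top_row (c0P _ cK) r'P) splitE // -cats1 big_cat big_seq1.
    by rewrite Er /= !/(cell_eval (k, _)) /= eqxx (negPf xk) !mulgA.
(* The largest column y > x is exchanged with x, since kyx = ykx. *)
have [[y /andP[kyS xy]]|noy] := pselect (exists y, ((k, y) \in S) && (x < y)).
  have [{xy kyS}y [kyS xy ymax]] : exists y : 'I_n,
      [/\ (k, y) \in S, x < y & forall j, (k, j) \in S -> j <= y].
    case: (@arg_maxnP _ y (fun y => ((k, y) \in S) && (x < y)) val).
      by rewrite kyS.
    move=> m /andP[kmS xm] mmax; exists m; split=> // j jS.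
    case: (leqP j x) => jx; last by apply: mmax; rewrite jS.
    exact: leq_trans (ltnW xm).
  have yk : y != k by apply: contraNneq kkS => e; rewrite -{2}e.
  (* A support containing an invalid cell belongs to no normal form. *)
  have [yK|Ky] := ltnP y K; last first.
    exists [::], [::] => c /allP cK cS.
    have := kyS; rewrite -cS inE => /cK/andP[_]; rewrite /cell_valid /= => yk'.
    by move: yk; rewrite -val_eqE /= eqn_leq yk' Ky.
  have [add [del IH]] := IHK y (ltnW Kn) yK [set t in S | t.1 != k].
  exists ((k, x) :: add), ((k, y) :: del) => c cK cS.
  have [|c' [c'P pc' Ec']] := IH _ (c0P _ cK); first by rewrite set_other_rows cS.
  have kyr : (k, y) \in row k c by rewrite mem_row -cS inE in kyS *.
  have [r [pr _ rP' _ Er]] := perm_row_rem (rP _ cK) kyr.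
  have r'P : all (in_row k) (rcons r (k, x)).
    by rewrite all_rcons rP' /in_row eqxx /cell_valid /= ltnW.
  exists (c' ++ rcons r (k, x)); split; first exact: catP c'P r'P.
    apply/permP => p; move/permP/(_ p): pc'.
    rewrite -cats1 !count_cat (count_rows k c) (permP pr) /=; lia.
  rewrite (@cells_eval_top_row k _ _ c'P r'P) splitE // -cats1 big_cat big_seq1.
  rewrite Er -Ec' /=.
  rewrite -!mulgA; congr (_ * _).
  have -> : cell_eval (k, y) * g x = g y * cell_eval (k, x).
    rewrite !/(cell_eval (k, _)) /= (negPf xk) (negPf yk) mulgA.
    have [xy' yk'] : x <= y /\ y <= k by split; apply: ltnW.
    by rewrite (g_zyx xy' yk') (g_zxy xy' yk').
  rewrite !mulgA; congr (_ * _); apply/esym/(row_commute_prod rP') => j jr jk.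
  apply/commute_sym/cell_commute_gen; last exact: ltnW.
  apply: ymax; have : (k, j) \in row k c by rewrite (perm_mem pr) inE jr orbT.
  by rewrite mem_row -cS inE.
(* All columns are at most x, so x commutes with the whole row. *)
have [add [del IH]] := IHK x (ltnW Kn) xK [set t in S | t.1 != k].
exists add, del => c cK cS.
have [|c' [c'P pc' Ec']] := IH _ (c0P _ cK); first by rewrite set_other_rows cS.
exists (c' ++ row k c); split; first exact: catP c'P (rP _ cK).
  apply/permP => p; move/permP/(_ p): pc'.
  rewrite !count_cat (count_rows k c) /=; lia.
rewrite (@cells_eval_top_row k _ _ c'P (rP _ cK)) splitE // -Ec' -!mulgA.
congr (_ * _).
apply/esym/row_commute_prod => [|j jr jk]; first exact: rP.
apply/commute_sym/cell_commute_gen; last exact: ltnW.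
rewrite leqNgt; apply/negP => xj; apply: noy; exists j.
by rewrite xj andbT -cS inE -(mem_row k).
Qed.

(** A letter [a] on its way up picks up the column of the first cell that it
    meets, and leaves the row of this cell behind as a single letter. *)
Lemma left_carry_single (a k j : 'I_n) : j < k -> k < a ->
  g a * cell_eval (k, j) = g k * cell_eval (a, j).
Proof.
move=> jk ka.
have jk' : (j == k) = false by rewrite -val_eqE /=; lia.
have ja' : (j == a) = false by rewrite -val_eqE /=; lia.
rewrite !/(cell_eval _) /= jk' ja' !mulgA.
by rewrite (g_zyx (ltnW jk) (ltnW ka)) (g_zxy (ltnW jk) (ltnW ka)).
Qed.

(** A cell (a, j) on its way up trades columns with a cell of smaller column;
    the cells of larger or equal column commute with it by [cell_commute_nested]. *)
Lemma left_carry_swap (a k i j : 'I_n) : i < j -> j < k -> k < a ->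
  cell_eval (a, j) * cell_eval (k, i) = cell_eval (k, j) * cell_eval (a, i).
Proof.
move=> ij jk ka.
have ja' : (j == a) = false by rewrite -val_eqE /=; lia.
have jk' : (j == k) = false by rewrite -val_eqE /=; lia.
have com : commute (g j) (cell_eval (k, i)).
  by apply/commute_sym/cell_commute_gen; exact: ltnW.
have com2 : commute (g j) (cell_eval (a, i)).
  by apply/commute_sym/cell_commute_gen; lia.
rewrite {1 3}/cell_eval /= ja' jk' -[LHS]mulgA com mulgA.
by rewrite left_carry_single ?(ltn_trans ij) // -!mulgA com2.
Qed.

(** The induction has to treat both shapes of the travelling element at once:
    the letter [a], and a cell (a, j) whose column comes from a lower row.
    In row [a] either of them is simply added to the row. *)
Lemma left_update (a : 'I_n) m K : K + m = a ->
  bounded_update (above K) (fun x => g a * x) /\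
  forall j : 'I_n, j < K ->
    bounded_update (above K) (fun x => cell_eval (a, j) * x).
Proof.
elim: m K => [|m IHm] K Ka.
  have insert (j : 'I_n) : j <= a ->
      bounded_update (above K) (fun x => cell_eval (a, j) * x).
    move=> ja S; exists [:: (a, j)], [::] => c cK _.
    have cat_above : all (above a.+1) (other_rows a c).
      apply/allP => t; rewrite mem_filter -val_eqE /above /= => /andP[ta].
      by move/allP: cK => /[apply] /andP[tK ->]; rewrite andbT; lia.
    have rP : all (in_row a) (row a c).
      by apply/all_row_valid/allP => t; move/allP: cK => /[apply] /andP[].
    have rP' : all (in_row a) ((a, j) :: row a c).
      by rewrite /= rP andbT /in_row eqxx.
    have pc : perm_eq c (row a c ++ other_rows a c).
      by apply: perm_trans (perm_rows a c) _; rewrite perm_catC.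
    exists ((a, j) :: c); split.
    - by rewrite /= cK andbT /above /cell_valid /= ja andbT; lia.
    - by rewrite cats0 -cat1s perm_catC.
    - rewrite (cells_eval_perm pc).
      rewrite (@cells_eval_perm (_ :: c) (((a, j) :: row a c) ++ other_rows a c)).
        by rewrite !(@cells_eval_bottom_row a) // big_cons mulgA.
      by rewrite /= perm_cons.
  split; last by move=> j jK; apply: insert; lia.
  have := insert a (leqnn a).
  by rewrite (_ : cell_eval (a, a) = g a) // /cell_eval /= eqxx.
have Kn : K < n by have := ltn_ord a; lia.
pose k := Ordinal Kn; have ka : k < a by rewrite /=; lia.
have [|IHa IHj] := IHm K.+1; first by lia.
have c1P c : all (above K) c -> all (above k.+1) (other_rows k c).
  move=> /allP cK; apply/allP => t; rewrite mem_filter -val_eqE /above /=.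
  by move=> /andP[tk /cK/andP[tK ->]]; rewrite andbT /=; lia.
have rP c : all (above K) c -> all (in_row k) (row k c).
  by move=> /allP cK; apply/all_row_valid/allP => t /cK/andP[].
have catP r c : all (in_row k) r -> all (above k.+1) c -> all (above K) (r ++ c).
  move=> /allP rk /allP cK; apply/allP => t; rewrite mem_cat /above.
  case/orP => [/rk/andP[/eqP tk ->]|/cK/andP[tK ->]]; first by rewrite tk leqnn.
  by rewrite andbT ltnW.
have splitE c : all (above K) c -> cells_eval c =
    \prod_(t <- row k c) cell_eval t * cells_eval (other_rows k c).
  move=> cK; rewrite (@cells_eval_perm c (row k c ++ other_rows k c)).
    by rewrite (cells_eval_bottom_row (rP _ cK) (c1P _ cK)).
  by apply: perm_trans (perm_rows k c) _; rewrite perm_catC.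
(* The situation after row k: the row has become r, and a cell (a, i) moves
   on to the rows above, where the induction hypothesis applies. *)
have leave (S : {set cell n}) (F : M -> M) (i : 'I_n) (add del : seq (cell n)) :
    i < K.+1 ->
    (forall c, all (above K) c -> [set t in c] = S ->
      exists r, [/\ all (in_row k) r, perm_eq (r ++ del) (row k c ++ add) &
        forall x, F (\prod_(t <- row k c) cell_eval t * x) =
                  \prod_(t <- r) cell_eval t * (cell_eval (a, i) * x)]) ->
    exists add del, forall c, all (above K) c -> [set t in c] = S ->
    exists c', [/\ all (above K) c', perm_eq (c' ++ del) (c ++ add)
                 & F (cells_eval c) = cells_eval c'].
  move=> iK rF; have [add' [del' IH]] := IHj i iK [set t in S | t.1 != k].
  exists (add ++ add'), (del ++ del') => c cK cS.
  have [r [rk pr Fr]] := rF c cK cS.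
  have [|c' [c'P pc' Ec']] := IH _ (c1P _ cK); first by rewrite set_other_rows cS.
  exists (r ++ c'); split; first exact: catP rk c'P.
    apply/permP => p; move/permP/(_ p): pc'; move/permP/(_ p): pr.
    rewrite !count_cat (count_rows k c) /=; lia.
  by rewrite splitE // Fr Ec' (@cells_eval_bottom_row k _ _ rk c'P).
have minP (S : {set cell n}) : (exists j, (k, j) \in S) ->
    exists2 i : 'I_n, (k, i) \in S & forall j : 'I_n, (k, j) \in S -> i <= j.
  case=> y yS; case: (@arg_minnP _ y (fun y => (k, y) \in S) val) => // i iS imin.
  by exists i => // j /imin.
split=> [S|j jK S].
  have [/minP[i iS imin]|noi] := pselect (exists j, (k, j) \in S); last first.
    have [add [del IH]] := IHa [set t in S | t.1 != k].
    exists add, del => c cK cS.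
    have [|c' [c'P pc' Ec']] := IH _ (c1P _ cK); first by rewrite set_other_rows cS.
    have rnil : row k c = [::].
      case r: (row k c) => [//|[k1 j] s]; case: noi; exists j.
      have : (k1, j) \in row k c by rewrite r mem_head.
      by rewrite mem_filter -cS inE => /andP[/eqP /= ->].
    have c1c : all (above K) c'.
      by apply: sub_all c'P => t /andP[tK vt]; rewrite /above vt andbT ltnW.
    exists c'; split=> //.
      apply: perm_trans pc' _; rewrite perm_cat2r perm_sym.
      by rewrite -[X in perm_eq _ X]cats0 -rnil perm_rows.
    by rewrite splitE // rnil big_nil mul1g.
  (* For i < k the letter k is left behind; for i = k nothing is. *)
  have [iK|Ki] := ltnP i K.
    apply: (@leave S _ i [:: (k, k)] [:: (k, i)]); first exact: ltnW.
    move=> c cK cS.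
    have kir : (k, i) \in row k c by rewrite mem_row -cS inE in iS *.
    have [r [pr _ rk Er _]] := perm_row_rem (rP _ cK) kir.
    exists ((k, k) :: r); split.
    - by rewrite /= rk /in_row /cell_valid eqxx leqnn.
    - apply/permP => p; rewrite !count_cat (permP pr) /=; lia.
    - move=> x; rewrite Er !mulgA left_carry_single // big_cons.
      rewrite {3}/cell_eval /= eqxx -!mulgA; congr (_ * _).
      rewrite !mulgA; congr (_ * _); apply: row_commute_prod rk _ => j jr jk.
      apply: cell_commute_nested => //; last exact: ltnW.
      apply: imin; rewrite -cS inE -(mem_row k) (perm_mem pr) inE jr orbT.
      by [].
  apply: (@leave S _ k [::] [:: (k, k)]) => // c cK cS.
  have eik : (k, i) \in row k c -> i = k.
    move=> ir; have /allP/(_ _ ir)/andP[_] := rP _ cK.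
    by rewrite /cell_valid /= => ik; apply: val_inj => /=; lia.
  have kir : (k, i) \in row k c by rewrite mem_row -cS inE in iS *.
  have ik := eik kir; rewrite {}ik in kir iS imin *.
  have [r [pr _ rk Er _]] := perm_row_rem (rP _ cK) kir.
  exists r; split=> // [|x].
    apply/permP => p; rewrite !count_cat (permP pr) /=; lia.
  rewrite Er !mulgA {1}/cell_eval /= eqxx.
  have -> : g a * g k = cell_eval (a, k).
    by rewrite /cell_eval /= ifF // -val_eqE /=; lia.
  congr (_ * _); apply: row_commute_prod rk _ => j jr jk.
  apply: cell_commute_nested => //; last exact: ltnW.
  apply: imin; rewrite -cS inE -(mem_row k) (perm_mem pr) inE jr orbT.
  by [].
(* If no column is below j, the cell (a, j) commutes with the whole row. *)
have [[y [yS yj]]|noi] := pselect (exists i, (k, i) \in S /\ i < j); last first.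
  apply: (@leave S _ j [::] [::]); first exact: ltnW.
  move=> c cK cS; exists (row k c); split=> [||x]; first exact: rP.
    by rewrite !cats0.
  rewrite !mulgA; congr (_ * _); apply: row_commute_prod (rP _ cK) _ => i ir ik.
  apply: cell_commute_nested => //; last exact: ltnW.
  rewrite leqNgt; apply/negP => ij; apply: noi; exists i.
  by rewrite ij -cS inE -(mem_row k).
(* Otherwise it trades columns with the first cell of the row, and then
   commutes with the remaining ones. *)
have [|i iS imin] := minP S; first by exists y.
have ij : i < j by apply: leq_ltn_trans yj; apply: imin.
apply: (@leave S _ i [:: (k, j)] [:: (k, i)]); first by lia.
move=> c cK cS.
have kir : (k, i) \in row k c by rewrite mem_row -cS inE in iS *.
have [r [pr _ rk Er _]] := perm_row_rem (rP _ cK) kir.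
exists ((k, j) :: r); split.
- by rewrite /= rk /in_row /cell_valid eqxx /= ltnW.
- apply/permP => p; rewrite !count_cat (permP pr) /=; lia.
- move=> x; rewrite Er !mulgA left_carry_swap // big_cons -!mulgA; congr (_ * _).
  rewrite !mulgA; congr (_ * _); apply: row_commute_prod rk _ => j' jr jk.
  apply: cell_commute_nested => //; last exact: ltnW.
  apply: imin; rewrite -cS inE -(mem_row k) (perm_mem pr) inE jr orbT.
  by [].
Qed.

Lemma right_mul_update a : bounded_update (@cell_valid n) (fun x => x * g a).
Proof.
have allE : all (@cell_valid n) =1 all (below n).
  by apply: eq_all => t; rewrite /below ltn_ord.
move=> S; have [add [del upd]] := right_update (leqnn n) (ltn_ord a) S.
exists add, del => c; rewrite allE => /upd/[apply] -[c' []].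
by rewrite -allE; exists c'.
Qed.

Lemma left_mul_update a : bounded_update (@cell_valid n) (fun x => g a * x).
Proof.
have [upd0 _] := left_update (add0n a).
move=> S; have [add [del upd]] := upd0 S.
by exists add, del.
Qed.

Lemma id_update : bounded_update (@cell_valid n) id.
Proof. by move=> S; exists [::], [::] => c vc _; exists c; split. Qed.

Lemma normal_form_exists w : exists c, all (@cell_valid n) c /\
  \prod_(x <- w) g x = cells_eval c.
Proof.
elim/last_ind: w => [|w a [c [vc Ec]]].
  by exists [::]; rewrite /cells_eval /sort !big_nil.
have [add [del upd]] := right_mul_update a [set t in c].
have [c' [vc' _ Ec']] := upd c vc erefl; exists c'; split=> //.
by rewrite -cats1 big_cat big_seq1 /= Ec.
Qed.

End ChineseRelations.

(** * Uniqueness of normal forms *)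

Section Uniqueness.
Context (n : nat).

(** Counts the unmatched opening brackets, where the letters >= [t] open and
    the letters < [s] close; the truncated predecessor discards an unmatched
    closing bracket. *)
Definition balance_step (s t i : nat) (a : 'I_n) : nat :=
  if t <= a then i.+1 else if a < s then i.-1 else i.

Definition balance s t : nat -> seq 'I_n -> nat := foldl (balance_step s t).

(** Let x <= y <= z.  If z opens and x closes, then z precedes x in each of zyx,
    zxy and yzx, so one pair cancels and at most one bracket is left, the same
    for all three.  Otherwise there are no closing or no opening brackets among
    the three letters, and their order is irrelevant. *)
Lemma chinese_balance s t i u v : s <= t ->
  presentation_cong (@chinese_rel n) u v -> balance s t i u = balance s t i v.
Proof.
move=> st cuv; elim: cuv i => {u v}.
- move=> p q u v uv i; rewrite /balance !foldl_cat; congr (foldl _ _ _).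
  move: (foldl _ i p) => {}i.
  by case: uv => x y z xy yz /=; rewrite /balance_step;
    repeat case: ifP => ?; lia.
- by [].
- by move=> u v _ IH i; rewrite IH.
- by move=> u v w _ IHu _ IHv i; rewrite IHu.
Qed.

Lemma chinese_count p u v :
  presentation_cong (@chinese_rel n) u v -> count p u = count p v.
Proof.
elim=> {u v}.
- move=> q r u v uv; rewrite !count_cat; congr (_ + (_ + _)).
  by case: uv => x y z _ _ /=; lia.
- by [].
- by move=> u v _ ->.
- by move=> u v w _ -> _ ->.
Qed.

Lemma count_cell_word p (t : cell n) :
  count p (cell_word t) = p t.1 + ((t.2 != t.1) && p t.2).
Proof. by rewrite /cell_word; case: eqP => /= [_|_]; rewrite ?addn0. Qed.

Lemma cells_word_cons (t : cell n) c :
  cells_word (t :: c) = cell_word t ++ cells_word c.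
Proof. by []. Qed.

(** The rows below [t] come first and contain closing brackets only, which are
    discarded.  In the later rows every cell begins with an opening bracket,
    which is closed within the cell exactly when the column is below [s]. *)
Lemma balance_normal s t (c : seq (cell n)) : s <= t ->
  sorted (@cell_le n) c -> all (@cell_valid n) c ->
  balance s t 0 (cells_word c) + count (fun u : cell n => (t <= u.1) && (u.2 < s)) c =
  count (fun a : 'I_n => t <= a) (cells_word c).
Proof.
move=> st sc vc.
have high i (c' : seq (cell n)) : all (fun u : cell n => t <= u.1) c' ->
    balance s t i (cells_word c') +
      count (fun u : cell n => (t <= u.1) && (u.2 < s)) c' =
    i + count (fun a : 'I_n => t <= a) (cells_word c').
  elim: c' i => [|[k j] c' IHc] i /=; first by rewrite !addn0.
  case/andP => tk tc'; rewrite cells_word_cons /balance foldl_cat -/(balance s t).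
  rewrite count_cat count_cell_word /= addnCA IHc // tk /=.
  rewrite /cell_word /= -val_eqE /=.
  case: eqP => [jk|jk] /=; rewrite /balance_step tk /=; first by lia.
  by case: (leqP t j) => tj; case: (ltnP j s) => js /=; lia.
elim: c sc vc => [|[k j] c IHc] //= sc /andP[]; rewrite /cell_valid /= => jk vc.
have [tk|kt] := leqP t k.
  rewrite -[RHS]add0n -high //= ?tk //.
  apply/allP => u uc; have := sc; rewrite path_sortedE; last exact: cell_le_trans.
  case/andP => /allP/(_ _ uc); rewrite /cell_le /= => uk _.
  by case/orP: uk => [uk|/andP[/eqP <- _]] //; exact: leq_trans tk (ltnW uk).
rewrite cells_word_cons count_cat count_cell_word /= -IHc ?(path_sorted sc) //.
rewrite [t <= k]leqNgt kt [t <= j]leqNgt (leq_ltn_trans jk kt) !andbF !add0n.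
congr (_ + _); rewrite /balance foldl_cat; congr foldl.
rewrite /cell_word /=; case: eqP => _ /=; rewrite /balance_step;
  by repeat case: ifP => //= ?; lia.
Qed.

(** Inclusion-exclusion on the quadrants {rows >= t, columns < s}.  When j < k
    all four of them satisfy s <= t, as [balance_normal] requires. *)
Lemma count_offdiag (k j : 'I_n) (c : seq (cell n)) :
  let Q s t := count (fun u : cell n => (t <= u.1) && (u.2 < s)) c in
  count_mem (k, j) c + Q j k + Q j.+1 k.+1 = Q j.+1 k + Q j k.+1.
Proof.
move=> Q; rewrite {}/Q; elim: c => //= -[k' j'] c IHc /=.
rewrite xpair_eqE -!val_eqE /=.
by case: (ltngtP k k'); case: (ltngtP j j') => /=; lia.
Qed.

(** The brackets determine the multiplicities of the cells (k, j) with j < k;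
    those of the cells (k, k) follow from the numbers of letters. *)
Lemma normal_form_unique (c c' : seq (cell n)) :
  sorted (@cell_le n) c -> all (@cell_valid n) c ->
  sorted (@cell_le n) c' -> all (@cell_valid n) c' ->
  presentation_cong (@chinese_rel n) (cells_word c) (cells_word c') ->
  c = c'.
Proof.
move=> sc vc sc' vc' cc'.
suff : perm_eq c c'.
  exact: sorted_eq (@cell_le_trans n) (@cell_le_anti n) _ _ sc sc'.
have eqQ s t : s <= t -> count (fun u : cell n => (t <= u.1) && (u.2 < s)) c =
                         count (fun u : cell n => (t <= u.1) && (u.2 < s)) c'.
  move=> st; apply: (@addnI (balance s t 0 (cells_word c'))).
  rewrite (balance_normal st sc' vc') -(chinese_balance 0 st cc').
  by rewrite (balance_normal st sc vc); apply: chinese_count.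
have offdiag (k j : 'I_n) : j < k -> count_mem (k, j) c = count_mem (k, j) c'.
  move=> jk; have /= := count_offdiag k j c; have /= := count_offdiag k j c'.
  have -> := eqQ j k (ltnW jk); have -> := eqQ j.+1 k jk.
  have -> := eqQ j.+1 k.+1 (ltnW (jk : j.+1 < k.+1)).
  by have -> := eqQ j k.+1 (ltnW (ltnW (jk : j.+1 < k.+1))); lia.
have poff : perm_eq [seq u <- c | u.2 != u.1] [seq u <- c' | u.2 != u.1].
  rewrite /perm_eq; apply/allP => -[k j] kj; apply/eqP; rewrite !count_filter.
  have : (j != k) && (j <= k).
    move: kj; rewrite mem_cat !mem_filter /= -andb_orr => /andP[->] /=.
    by case/orP => [/(allP vc)|/(allP vc')].
  rewrite -ltn_neqAle => jk.
  rewrite !(eq_count (a2 := pred1 (k, j))); first exact: offdiag.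
    move=> [k' j'] /=; case: eqP => //= -[-> ->].
    by rewrite neq_ltn jk.
  move=> [k' j'] /=; case: eqP => //= -[-> ->].
  by rewrite neq_ltn jk.
have cntE (d : seq (cell n)) (k : 'I_n) : count_mem k (cells_word d) =
    count_mem (k, k) d + count (fun u : cell n => (u.1 == k) && (u.2 != u.1)) d +
    count (fun u : cell n => (u.2 == k) && (u.2 != u.1)) d.
  elim: d => //= -[k' j'] d IHd; rewrite cells_word_cons count_cat count_cell_word.
  rewrite IHd /= xpair_eqE -!val_eqE /=; lia.
rewrite /perm_eq; apply/allP => -[k j] kj; apply/eqP => /=.
have jk : j <= k.
  by move: kj; rewrite mem_cat => /orP[/(allP vc)|/(allP vc')].
have [e|jk'] := eqVneq j k; last by apply: offdiag; rewrite ltn_neqAle jk'.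
have offp (p : pred (cell n)) : count (fun u => p u && (u.2 != u.1)) c =
                               count (fun u => p u && (u.2 != u.1)) c'.
  by have /permP/(_ p) := poff; rewrite !count_filter.
rewrite e; have := chinese_count (pred1 k) cc'; rewrite !cntE.
rewrite (offp (fun u => u.1 == k)) (offp (fun u => u.2 == k)).
by move/addIn/addIn.
Qed.

End Uniqueness.

(** * The language L consists of the sorted words of cells *)

Section SortedLanguages.
Context (D : Type) (le : rel D).
Context (le_trans : transitive le) (le_refl : reflexive le).

Definition sorted_lang (p : pred D) : set (seq D) :=
  [set w | sorted le w && all p w].

(** The strict comparison makes the factorisation possible: in a sorted word
    no letter of [p] follows a letter of [q]. *)
Lemma sorted_lang_cat (p q : pred D) :
  (forall x y, p x -> q y -> le x y && ~~ le y x) ->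
  lang_cat (sorted_lang p) (sorted_lang q) = sorted_lang (predU p q).
Proof.
move=> pq; apply/seteqP; split=> w.
  case=> u /andP[su pu] [v /andP[sv qv] <-]; apply/andP; split.
    move: su sv; rewrite !sorted_pairwise // pairwise_cat => -> ->; rewrite !andbT.
    elim: u pu => //= x u IHu /andP[px /IHu uv]; rewrite allrel_consl uv andbT.
    by apply: sub_all qv => y /(pq _ _ px)/andP[].
  rewrite all_cat; apply/andP; split; [apply: sub_all pu|apply: sub_all qv].
    by move=> x /= ->.
  by move=> x /= ->; rewrite orbT.
elim: w => [_|x w IHw /andP[/= xw /andP[pqx pqw]]].
  by exists [::] => //; exists [::].
have [|u /andP[su pu] [v /andP[sv qv] uvw]] := IHw.
  by apply/andP; rewrite (path_sorted xw) pqw.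
move: xw; rewrite -uvw path_sortedE // all_cat => /andP[/andP[xu xv] _].
have [px|npx] := boolP (p x).
  exists (x :: u); last by exists v => //; rewrite /sorted_lang /= sv qv.
  by rewrite /sorted_lang /= path_sortedE // xu su px.
have qx : q x by move: pqx; rewrite /= (negPf npx).
have u0 : u = [::].
  case: u pu xu {su uvw} => //= y u /andP[py _] /andP[xy _].
  by have := pq _ _ py qx; rewrite xy andbF.
rewrite u0; exists [::] => //; exists (x :: v) => //.
by rewrite /sorted_lang /= path_sortedE // xv sv qx.
Qed.

Lemma sorted_lang_eq p q : p =1 q -> sorted_lang p = sorted_lang q.
Proof.
by move=> pq; apply/seteqP; split=> w; rewrite /sorted_lang /= (eq_all pq).
Qed.

Lemma sorted_lang_big (I : eqType) (lt : rel I) (s : seq I)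
    (L : I -> set (seq D)) (p : I -> pred D) :
  pairwise lt s -> (forall i, L i = sorted_lang (p i)) ->
  (forall i j x y, lt i j -> p i x -> p j y -> le x y && ~~ le y x) ->
  \big[@lang_cat D/@lang_eps D]_(i <- s) L i =
  sorted_lang (fun x => has (fun i => p i x) s).
Proof.
move=> lts Lp ltp; elim: s lts => [_|i s IHs /= /andP[/allP lti /IHs {}IHs]].
  rewrite big_nil; apply/seteqP; split=> [w ->//|[//|x w]].
  by rewrite /sorted_lang /= andbF.
rewrite big_cons IHs Lp sorted_lang_cat // => x y px /hasP[j /lti ij].
exact: ltp ij px.
Qed.

Lemma sorted_lang_powers x (p : pred D) : (forall y, p y <-> y = x) ->
  lang_powers x = sorted_lang p.
Proof.
move=> px; apply/seteqP; split=> [_ [m _ <-]|w].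
  apply/andP; split; last by rewrite all_nseq; apply/orP; right; apply/px.
  by elim: m => //= -[|m] //= ->; rewrite le_refl.
case/andP => _ pw; exists (size w) => //.
by elim: w pw => //= y w IHw /andP[/px -> /IHw ->].
Qed.

End SortedLanguages.

Section ChineseLanguage.
Context (n : nat).

Definition dsym_cell (d : dsym n) : cell n :=
  match d with
  | d_pair k j => (k, widen_ord (ltnW (ltn_ord k)) j)
  | d_single k => (k, k)
  end.

Definition dsym_le : rel (dsym n) :=
  fun d d' => cell_le (dsym_cell d) (dsym_cell d').

Lemma dsym_le_trans : transitive dsym_le.
Proof. by move=> x y z; apply: cell_le_trans. Qed.

Lemma subscriptsE d : subscripts d = cell_word (dsym_cell d).
Proof.
case: d => [k j|k]; rewrite /cell_word /=; last by rewrite eqxx.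
by rewrite -val_eqE /= ltn_eqF.
Qed.

Lemma readoffE u' u : readoff u' u <-> u = cells_word [seq dsym_cell d | d <- u'].
Proof.
split=> [|->]; first by elim=> // d v' v _ ->; rewrite subscriptsE.
elim: u' => [|d u' IHu]; first exact: readoff_nil.
by rewrite /= cells_word_cons -subscriptsE; apply: readoff_cons.
Qed.

Lemma dsym_cell_valid d : cell_valid (dsym_cell d).
Proof. by case: d => [k j|k]; rewrite /cell_valid //= ltnW. Qed.

Lemma dsym_of_cell t : cell_valid t -> exists d, dsym_cell d = t.
Proof.
case: t => k j; rewrite /cell_valid /= leq_eqVlt => /orP[/eqP jk|jk].
  by exists (d_single k); congr (_, _); apply: val_inj.
by exists (@d_pair n k (Ordinal jk)); congr (_, _); apply: val_inj.
Qed.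

Lemma pairwise_index_enum m : pairwise (fun i j : 'I_m => i < j) (index_enum 'I_m).
Proof.
have : pairwise ltn (map val (index_enum 'I_m)).
  rewrite /index_enum; case: index_enum_key; rewrite /= -enumT val_enum_ord.
  by rewrite -sorted_pairwise ?iota_ltn_sorted //; apply: ltn_trans.
by rewrite pairwise_map.
Qed.

Lemma dsym_cell_inj : injective dsym_cell.
Proof.
have lt_neq (k : 'I_n) (j : 'I_k) : (j == k :> nat) = false by rewrite ltn_eqF.
case=> [k j|k] [k' j'|k'] [kk']; first by subst k' => /val_inj ->.
- by subst k' => /(congr1 (@nat_of_ord n)) /= h; have := lt_neq k j; rewrite h eqxx.
- by subst k' => /(congr1 (@nat_of_ord n)) /= h; have := lt_neq k j'; rewrite -h eqxx.
- by rewrite kk'.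
Qed.

Lemma lang_powers_dsym d :
  lang_powers d = sorted_lang dsym_le (fun d' => dsym_cell d' == dsym_cell d).
Proof.
apply: sorted_lang_powers => [d'|d']; first exact: cell_le_refl.
by split=> [/eqP/dsym_cell_inj|->].
Qed.

Lemma cell_le_strict (t t' : cell n) :
  (t.1 < t'.1) || (t.1 == t'.1) && (t.2 < t'.2) -> cell_le t t' && ~~ cell_le t' t.
Proof. by case: t t' => [a b] [a' b']; rewrite /cell_le -!val_eqE /=; lia. Qed.

Lemma chinese_KblockE k : @chinese_Kblock n k =
  sorted_lang dsym_le (fun d => (dsym_cell d).1 == k).
Proof.
rewrite /chinese_Kblock lang_powers_dsym (sorted_lang_big dsym_le_trans
  (pairwise_index_enum k) (fun j => lang_powers_dsym (d_pair j))).
  rewrite sorted_lang_cat; first apply: sorted_lang_eq => d.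
  - rewrite /=; apply/orP/eqP => [[/hasP[j _ /eqP->]|/eqP->] //|].
    case: d => [k' j|k'] /= e; [left|by right; rewrite e].
    by subst k'; apply/hasP; exists j; rewrite ?mem_index_enum.
  - exact: dsym_le_trans.
  - move=> d d' /hasP[j _ /eqP dj] /eqP d'k; apply: cell_le_strict.
    by rewrite dj d'k /= eqxx ltn_ord orbT.
move=> j j' d d' jj' /eqP dj /eqP dj'; apply: cell_le_strict.
by rewrite dj dj' /= eqxx jj' orbT.
Qed.

Lemma chinese_KE : @chinese_K n = sorted_lang dsym_le predT.
Proof.
rewrite /chinese_K (sorted_lang_big dsym_le_trans
  (pairwise_index_enum n) chinese_KblockE).
  apply: sorted_lang_eq => d; apply/hasP.
  by exists (dsym_cell d).1; rewrite ?mem_index_enum.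
move=> k k' d d' kk' /eqP dk /eqP d'k; apply: cell_le_strict.
by rewrite dk d'k kk'.
Qed.

Lemma chinese_langE w : chinese_lang w <->
  exists c : seq (cell n), [/\ sorted (@cell_le n) c, all (@cell_valid n) c
                             & w = cells_word c].
Proof.
split=> [[u]|[c [sc vc ->]]].
  rewrite chinese_KE => /andP[su _] /readoffE ->.
  exists [seq dsym_cell d | d <- u]; split=> //; first by rewrite sorted_map.
  by elim: u {su} => //= d u ->; rewrite dsym_cell_valid.
have [u uc] : exists u, [seq dsym_cell d | d <- u] = c.
  elim: c vc {sc} => [|t c IHc] /=; first by exists [::].
  case/andP => /dsym_of_cell[d <-] /IHc[u <-].
  by exists (d :: u).
exists u; last by apply/readoffE; rewrite uc.
rewrite chinese_KE; apply/andP; split; last exact: all_predT.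
by move: sc; rewrite -uc sorted_map.
Qed.

End ChineseLanguage.

(** * Regularity from a finite right invariant *)

(** The states are the values of [f].  Since [f] need not be a right
    congruence, the transition from a state picks some word with that value;
    the state reached by [w] is then the value of a word that has the same
    right continuations into [X] as [w]. *)
Lemma nerode_regular (S T : finType) (X : set (seq S)) (f : seq S -> T) :
  (forall w w' s, f w = f w' -> X (w ++ s) -> X (w' ++ s)) -> regular X.
Proof.
move=> fX.
pose step t a := if pselect (exists w, f w = t) is left e
  then f (rcons (projT1 (cid e)) a) else t.
pose M := @Dfa S T (f [::]) step [set t | `[< exists2 w, f w = t & X w >]]%SET.
exists M; apply/seteqP.
have run w : exists2 w', foldl step (f [::]) w = f w' &
    forall s, X (w' ++ s) <-> X (w ++ s).
  elim/last_ind: w => [|w a [w' fw' Xw']]; first by exists [::].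
  rewrite -cats1 foldl_cat /= fw' /step.
  case: pselect => [e|[]]; last by exists w'.
  case: (cid e) => /= w2 fw2; exists (rcons w2 a) => // s.
  rewrite -cats1 -!catA -Xw'.
  by split; apply: fX; rewrite fw2.
split=> w; rewrite /dfa_lang /= inE; have [w' fw' Xw'] := run w.
  case/asboolP => w2 fw2 Xw2.
  have := Xw' [::]; rewrite !cats0 => <-; rewrite -[w']cats0.
  by apply: fX (w2) _ _ _ _; rewrite ?cats0 // fw2.
move=> Xw; apply/asboolP; exists w' => //.
by have := Xw' [::]; rewrite !cats0 => ->.
Qed.

Section SortedState.
Context (T : eqType) (e : rel T).

Definition last_opt (c : seq T) : option T :=
  if c is x :: c' then Some (last x c') else None.

(** What an automaton has to know about a prefix in order to decide whether a
    word is sorted. *)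
Definition sorted_state (c : seq T) : option (option T) :=
  if sorted e c then Some (last_opt c) else None.

Lemma sorted_state_cat c c' s : sorted_state c = sorted_state c' ->
  sorted e (c ++ s) = sorted e (c' ++ s).
Proof.
have catE d : sorted e (d ++ s) = sorted e d &&
    (if last_opt d is Some x then path e x s else sorted e s).
  by case: d => [|x d] //=; rewrite cat_path.
by rewrite /sorted_state !catE; do 2 case: ifP => //; move=> _ _ [->].
Qed.

End SortedState.

(** * Padded pairs of words *)

#[local] Arguments deltaR : simpl never.
#[local] Arguments deltaL : simpl never.

Section Padding.
Context (A : Type).
Local Notation pair_letter := (option A * option A)%type.

Definition left_word (z : seq pair_letter) : seq A := pmap fst z.
Definition right_word (z : seq pair_letter) : seq A := pmap snd z.

(** Right padding is a local condition: once a component has ended it does not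
    resume, and the two components have not both ended. *)
Definition padR_rel : rel pair_letter := fun x y =>
  (~~ x.1 ==> ~~ y.1) && (~~ x.2 ==> ~~ y.2).

Definition nonempty_letter : pred pair_letter := fun x => x.1 || x.2.

(** The facts shared by the two paddings.  The shape being local, it is
    recognised by remembering the last letter; only the direction in which
    [e] reads the word distinguishes left from right. *)
Record padding (d : seq A * seq A -> seq pair_letter) (e : rel pair_letter) :=
  Padding {
  pad_left p : left_word (d p) = p.1;
  pad_right p : right_word (d p) = p.2;
  pad_size p : size (d p) = maxn (size p.1) (size p.2);
  pad_shape z : z = d (left_word z, right_word z) <->
                sorted e z && all nonempty_letter z }.

Lemma deltaR_nil_l (v : seq A) : deltaR ([::], v) = [seq (None, Some b) | b <- v].
Proof. by rewrite /deltaR /= subn0 cats0; elim: v => //= b v ->. Qed.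

Lemma deltaR_nil_r (u : seq A) : deltaR (u, [::]) = [seq (Some a, None) | a <- u].
Proof. by rewrite /deltaR /= subn0 cats0; elim: u => //= b v ->. Qed.

Lemma deltaR_cons a b (u v : seq A) :
  deltaR (a :: u, b :: v) = (Some a, Some b) :: deltaR (u, v).
Proof. by rewrite /deltaR /= !subSS. Qed.

Lemma padR_padding : padding (@deltaR A) padR_rel.
Proof.
have lr : forall u v : seq A, [/\ left_word (deltaR (u, v)) = u,
    right_word (deltaR (u, v)) = v, size (deltaR (u, v)) = maxn (size u) (size v),
    sorted padR_rel (deltaR (u, v)) & all nonempty_letter (deltaR (u, v))].
  elim=> [|a u IHu] [|b v].
  - by [].
  - rewrite deltaR_nil_l /left_word /right_word size_map max0n all_map.
    split=> //; first by elim: (b :: v).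
    - by elim: (b :: v) => //= x w ->.
    - by rewrite /=; elim: v b => //= x w IH _; rewrite IH.
    - by elim: (b :: v) => //= x w ->.
  - rewrite deltaR_nil_r /left_word /right_word size_map maxn0 all_map.
    split=> //; first by elim: (a :: u) => //= x w ->.
    - by elim: (a :: u).
    - by rewrite /=; elim: u a {IHu} => //= x w IH _; rewrite IH.
    - by elim: (a :: u) => //= x w ->.
  have [l r s so al] := IHu v; rewrite deltaR_cons /left_word /right_word /=.
  split; rewrite ?[pmap _ _]l ?[pmap _ _]r ?s ?maxnSS //=.
  by case: deltaR so => //= x w ->.
split=> [[u v]|[u v]|[u v]|z]; try by case: (lr u v).
split=> [->|]; first by case: (lr (left_word z) (right_word z)) => _ _ _ -> ->.
have none1 x w : path padR_rel x w -> all nonempty_letter w -> x.1 = None ->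
    left_word w = [::] /\ w = [seq (None, Some b) | b <- right_word w].
  elim: w x => //= y w IHw x /andP[xy yw] /andP[ny nw] x1.
  have y1 : y.1 = None by move: xy; rewrite /padR_rel x1 /=; case: y.1.
  have [lw rw] := IHw _ yw nw y1; rewrite /left_word /right_word /= y1.
  move: ny; rewrite /nonempty_letter.
  by case: y y1 {xy yw} => /= _ [b|] -> //= _; rewrite -rw.
have none2 x w : path padR_rel x w -> all nonempty_letter w -> x.2 = None ->
    right_word w = [::] /\ w = [seq (Some b, None) | b <- left_word w].
  elim: w x => //= y w IHw x /andP[xy yw] /andP[ny nw] x1.
  have y1 : y.2 = None.
    by move: xy; rewrite /padR_rel x1 /= => /andP[_]; case: y.2.
  have [lw rw] := IHw _ yw nw y1; rewrite /left_word /right_word /= y1.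
  move: ny; rewrite /nonempty_letter.
  by case: y y1 {xy yw} => /= [[b|]] _ -> //= _; rewrite -rw.
elim: z => //= -[[a|] [b|]] z IHz //= /andP[zp nz].
- rewrite /left_word /right_word /= deltaR_cons -IHz // nz andbT.
  exact: path_sorted zp.
- have [rw lw] := none2 _ _ zp nz erefl.
  by rewrite /left_word /right_word /= -/(left_word z) -/(right_word z) rw
    deltaR_nil_r /= -lw.
- have [lw rw] := none1 _ _ zp nz erefl.
  by rewrite /left_word /right_word /= -/(left_word z) -/(right_word z) lw
    deltaR_nil_l /= -rw.
- by [].
Qed.

Lemma left_word_rev z : left_word (rev z) = rev (left_word z).
Proof.
elim: z => //= x z IHz; rewrite /left_word rev_cons -cats1 pmap_cat /=.
by rewrite [pmap _ _]IHz; case: x.1 => [a|] /=; rewrite ?cats0 // rev_cons cats1.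
Qed.

Lemma right_word_rev z : right_word (rev z) = rev (right_word z).
Proof.
elim: z => //= x z IHz; rewrite /right_word rev_cons -cats1 pmap_cat /=.
by rewrite [pmap _ _]IHz; case: x.2 => [a|] /=; rewrite ?cats0 // rev_cons cats1.
Qed.

Lemma deltaL_rev (u v : seq A) : deltaL (u, v) = rev (deltaR (rev u, rev v)).
Proof.
rewrite /deltaL /deltaR !size_rev rev_zip; last first.
  by rewrite !size_cat !size_map !size_nseq !size_rev -!maxnE maxnC.
by rewrite !rev_cat !map_rev !revK !rev_nseq.
Qed.

Lemma padL_padding : padding (@deltaL A) (fun x y => padR_rel y x).
Proof.
have [pl pr ps pz] := padR_padding.
split=> [[u v]|[u v]|[u v]|z].
- by rewrite deltaL_rev left_word_rev pl revK.
- by rewrite deltaL_rev right_word_rev pr revK.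
- by rewrite deltaL_rev size_rev ps !size_rev.
- rewrite -rev_sorted -all_rev -pz deltaL_rev left_word_rev right_word_rev.
  by split=> [{1}->|<-]; rewrite revK.
Qed.

End Padding.

(** * Decoding words into cells *)

Section Decoder.
Context (n : nat).

(** The transducer reads a word into cells with a delay of one letter: a letter
    [k] is kept pending until the next one tells whether it begins a cell (k, x)
    with x < k.  After a complete cell of a sorted word the next letter is not
    smaller than the row, so no other parsing of such a word is possible. *)
Definition decode_step (o : option 'I_n) (x : 'I_n) :
    option 'I_n * seq (cell n) :=
  if o is Some k then
    if x < k then (None, [:: (k, x)]) else (Some x, [:: (k, k)])
  else (Some x, [::]).

Definition pending (o : option 'I_n) (w : seq 'I_n) : option 'I_n :=
  foldl (fun o x => (decode_step o x).1) o w.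

Fixpoint emitted (o : option 'I_n) (w : seq 'I_n) : seq (cell n) :=
  if w is x :: w' then
    (decode_step o x).2 ++ emitted (decode_step o x).1 w'
  else [::].

Definition decode_from (o : option 'I_n) (w : seq 'I_n) : seq (cell n) :=
  emitted o w ++ (if pending o w is Some k then [:: (k, k)] else [::]).

Definition decode := decode_from None.

Lemma pending_cat o u v : pending o (u ++ v) = pending (pending o u) v.
Proof. exact: foldl_cat. Qed.

Lemma emitted_cat o u v :
  emitted o (u ++ v) = emitted o u ++ emitted (pending o u) v.
Proof. by elim: u o => //= x u IHu o; rewrite IHu catA. Qed.

Lemma decode_cat u v :
  decode (u ++ v) = emitted None u ++ decode_from (pending None u) v.
Proof. by rewrite /decode /decode_from pending_cat emitted_cat catA. Qed.

Lemma cells_word_cat (c c' : seq (cell n)) :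
  cells_word (c ++ c') = cells_word c ++ cells_word c'.
Proof. by rewrite /cells_word map_cat flatten_cat. Qed.

Lemma emitted_word o w :
  cells_word (emitted o w) ++ seq_of_opt (pending o w) = seq_of_opt o ++ w.
Proof.
elim: w o => [|x w IHw] o /=; first by rewrite cats0.
rewrite cells_word_cat -catA IHw catA -[x :: w]cat1s [RHS]catA; congr (_ ++ _).
case: o => [k|] //=; case: ltnP => [xk|kx] /=.
  by rewrite /cells_word /= /cell_word /= -val_eqE /= ltn_eqF.
by rewrite /cells_word /= /cell_word /= eqxx.
Qed.

Lemma size_emitted w :
  size (cells_word (emitted None w)) <= size w <=
  (size (cells_word (emitted None w))).+1.
Proof.
have := congr1 size (emitted_word None w); rewrite size_cat /= => <-.
by case: pending => /= [_|]; lia.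
Qed.

Lemma decodeK w : cells_word (decode w) = w.
Proof.
rewrite /decode /decode_from cells_word_cat -[RHS](emitted_word None w).
congr (_ ++ _); case: pending => //= k.
by rewrite /cells_word /= /cell_word /= eqxx.
Qed.

Lemma decode_valid w : all (@cell_valid n) (decode w).
Proof.
rewrite /decode /decode_from all_cat; apply/andP; split; last first.
  by case: pending => //= k; rewrite /cell_valid leqnn.
elim: w None => //= x w IHw o; rewrite all_cat IHw andbT.
case: o => [k|] //=; case: ltnP => xk /=; rewrite andbT /cell_valid //=.
exact: ltnW.
Qed.

Lemma cells_wordK (c : seq (cell n)) :
  sorted (@cell_le n) c -> all (@cell_valid n) c -> decode (cells_word c) = c.
Proof.
elim: c => [|[k j] c IHc] //= pc /andP[]; rewrite /cell_valid /= => jk vc.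
have {IHc} := IHc (path_sorted pc) vc; rewrite cells_word_cons /cell_word /=.
rewrite /decode /decode_from; case: eqP => [->|jk'] /= IHc.
  case: c pc vc IHc => [//|[k' j'] c] /= /andP[kk' _] _.
  have {}kk' : (k' < k) = false.
    by apply/negP => h; move: kk'; rewrite /cell_le /= -val_eqE /=; lia.
  by rewrite cells_word_cons /cell_word /=; case: eqP => _ /=; rewrite kk' /= => ->.
have -> /= : j < k.
  by rewrite ltn_neqAle jk andbT; apply/eqP => h; apply/jk'/val_inj.
by rewrite IHc.
Qed.

Lemma size_cells_word (c : seq (cell n)) :
  size (cells_word c) = \sum_(t : cell n) count_mem t c * size (cell_word t).
Proof.
elim: c => [|t c IHc]; first by rewrite big1.
rewrite cells_word_cons size_cat IHc [RHS](bigD1 t) //= [X in _ + X](bigD1 t) //=.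
rewrite eqxx mulnDl mul1n -addnA; congr (_ + (_ + _)).
by apply: eq_bigr => u ut; rewrite eq_sym (negPf ut).
Qed.

Lemma size_cell_word (t : cell n) : 0 < size (cell_word t) <= 2.
Proof. by rewrite /cell_word; case: ifP. Qed.

Lemma size_cells_word_bound (c : seq (cell n)) : size (cells_word c) <= 2 * size c.
Proof.
elim: c => // t c IHc; rewrite cells_word_cons size_cat mulnS leq_add //.
by case/andP: (size_cell_word t).
Qed.

(** If [c1] contained far more copies of [t] than [c1'], then [t] would still
    occur in [c2'], so that [c1'] would contain only cells up to [t], while
    [c1] would already contain all the cells below [t].  The multiplicities of
    these cells being close, [c1] would be much longer than [c1']. *)
Lemma count_lag (c1 c2 c1' c2' : seq (cell n)) b l (t : cell n) :
  sorted (@cell_le n) (c1 ++ c2) -> sorted (@cell_le n) (c1' ++ c2') ->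
  (forall u, count_mem u (c1 ++ c2) <= count_mem u (c1' ++ c2') + b) ->
  (forall u, count_mem u (c1' ++ c2') <= count_mem u (c1 ++ c2) + b) ->
  size (cells_word c1) <= size (cells_word c1') + l ->
  count_mem t c1 <= count_mem t c1' + (b + l + #|{: cell n}| * (2 * b)).
Proof.
move=> sc sc' cc' c'c szl; rewrite leqNgt; apply/negP => tlag.
have sortP (d d' : seq (cell n)) : sorted (@cell_le n) (d ++ d') ->
    forall u v, u \in d -> v \in d' -> cell_le u v.
  rewrite sorted_pairwise; last exact: cell_le_trans.
  by rewrite pairwise_cat => /andP[/allrelP].
have tc1 : t \in c1 by rewrite -has_pred1 has_count; lia.
have tc2' : t \in c2'.
  by rewrite -has_pred1 has_count; have := cc' t; rewrite !count_cat; lia.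
have others u : u != t -> count_mem u c1' <= count_mem u c1 + b.
  move=> ut; have [uc1'|/count_memPn->//] := boolP (u \in c1').
  have /count_memPn uc2 : u \notin c2.
    apply: contra_neqN ut => uc2; apply: (@cell_le_anti n).
    by rewrite (sortP _ _ sc' u t) // (sortP _ _ sc t u).
  by have := c'c u; rewrite !count_cat uc2; lia.
move: szl; rewrite !size_cells_word (bigD1 t) //= [X in _ <= X + _](bigD1 t) //=.
have : \sum_(u | u != t) count_mem u c1' * size (cell_word u) <=
       \sum_(u | u != t) count_mem u c1 * size (cell_word u) +
       #|{: cell n}| * (2 * b).
  apply: (@leq_trans (\sum_(u | u != t)
    (count_mem u c1 * size (cell_word u) + 2 * b))).
    apply: leq_sum => u ut; have := others u ut.
    have /andP[_] := size_cell_word u; move: (size _) => m m2 h.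
    apply: (leq_trans (leq_mul h (leqnn m))); rewrite mulnDl leq_add2l mulnC.
    by rewrite leq_mul2r m2 orbT.
  rewrite big_split leq_add2l sum_nat_const leq_mul2r max_card orbT.
  by [].
have /andP[m1 _] := size_cell_word t.
move: (\sum_(_ | _) _) (\sum_(_ | _) _) (size (cell_word t)) m1 => s s' m m1.
pose K := b + l + #|{: cell n}| * (2 * b).
have : (count_mem t c1' + K.+1) * m <= count_mem t c1 * m.
  by rewrite addnS leq_mul2r tlag orbT.
have : l + #|{: cell n}| * (2 * b) < K.+1 * m.
  by apply: leq_trans (leq_pmulr _ m1); rewrite ltnS /K -addnA leq_addl.
rewrite mulnDl; move: (_ * (2 * b)) (K.+1 * m) (count_mem t c1' * m).
by move: (count_mem t c1 * m) => *; lia.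
Qed.

End Decoder.

(** * An automaton for bounded updates *)

Section UpdateAutomaton.
Context (n : nat) (add del : {set cell n} -> seq (cell n)).

(** The pairs of words of L in which the second is obtained from the first by
    a bounded update; with [add] and [del] empty this is equality on L. *)
Definition update_rel : set (seq 'I_n * seq 'I_n) := [set p |
  let c := decode p.1 in let c' := decode p.2 in
  let S := [set t in c]%SET in
  [/\ sorted (@cell_le n) c, sorted (@cell_le n) c'
    & perm_eq (c' ++ del S) (c ++ add S)]].

(** At most [update_size] cells are changed by an update, so the components of
    a padded pair, or of a prefix of it, differ in length by at most
    [2 * update_size].  With one more letter possibly pending, [count_lag]
    then bounds the difference of multiplicities by [update_lag]. *)
Definition update_size : nat :=
  \max_(S : {set cell n}) (size (add S) + size (del S)).

Definition update_lag : nat :=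
  update_size + (2 * update_size).+1 + #|{: cell n}| * (2 * update_size).

Lemma update_size_le S : size (add S) + size (del S) <= update_size.
Proof. exact: (leq_bigmax (F := fun S => size (add S) + size (del S))). Qed.

Lemma update_rel_size p : update_rel p ->
  size p.1 <= size p.2 + 2 * update_size /\
  size p.2 <= size p.1 + 2 * update_size.
Proof.
case: p => u v [_ _ /= pS]; have := update_size_le [set t in decode u]%SET.
move: (add _) (del _) pS => a d pS ad.
have : size (cells_word (decode v ++ d)) = size (cells_word (decode u ++ a)).
  by rewrite !size_cells_word; apply: eq_bigr => t _; rewrite (permP pS).
rewrite (cells_word_cat _ d) (cells_word_cat _ a) !size_cat !decodeK.
have := size_cells_word_bound a; have := size_cells_word_bound d; lia.
Qed.

Lemma update_rel_count p t : update_rel p ->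
  count_mem t (decode p.1) <= count_mem t (decode p.2) + update_size /\
  count_mem t (decode p.2) <= count_mem t (decode p.1) + update_size.
Proof.
case: p => u v [_ _ /= /permP/(_ (pred1 t))].
have := update_size_le [set t in decode u]%SET.
move: (add _) (del _) => a d; move: (decode u) (decode v) => c c'; rewrite !count_cat.
have : count_mem t a <= size a := count_size _ _.
have : count_mem t d <= size d := count_size _ _.
move: (count_mem t a) (count_mem t d) (count_mem t c) (count_mem t c').
lia.
Qed.

Context (d : seq 'I_n * seq 'I_n -> seq (option 'I_n * option 'I_n)).
Context (e : rel (option 'I_n * option 'I_n)) (d_pad : padding d e).

Lemma left_word_cat A (z s : seq (option A * option A)) :
  left_word (z ++ s) = left_word z ++ left_word s.
Proof. exact: pmap_cat. Qed.

Lemma right_word_cat A (z s : seq (option A * option A)) :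
  right_word (z ++ s) = right_word z ++ right_word s.
Proof. exact: pmap_cat. Qed.

(** The components of a prefix differ in length by at most the total padding. *)
Lemma update_prefix_size p z s : update_rel p -> z ++ s = d p ->
  size (left_word z) <= size (right_word z) + 2 * update_size /\
  size (right_word z) <= size (left_word z) + 2 * update_size.
Proof.
move=> /update_rel_size szp zs.
have := congr1 size (pad_left d_pad p); have := congr1 size (pad_right d_pad p).
have := congr1 size zs; rewrite (pad_size d_pad) -zs.
rewrite left_word_cat right_word_cat !size_cat.
have szl (x : seq (option 'I_n * option 'I_n)) : size (left_word x) <= size x.
  by rewrite size_pmap count_size.
have szr (x : seq (option 'I_n * option 'I_n)) : size (right_word x) <= size x.
  by rewrite size_pmap count_size.
have := szl z; have := szr z; have := szl s; have := szr s; lia.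
Qed.

Lemma update_prefix_count p z s t : update_rel p -> z ++ s = d p ->
  let c := emitted None (left_word z) in
  let c' := emitted None (right_word z) in
  count_mem t c <= count_mem t c' + update_lag /\
  count_mem t c' <= count_mem t c + update_lag.
Proof.
move=> Rp zs; have [szl szr] := update_prefix_size Rp zs.
have cnt u := update_rel_count u Rp.
have [sc sc' _] := Rp; move: sc sc' cnt.
rewrite -(pad_left d_pad p) -(pad_right d_pad p) -zs left_word_cat right_word_cat.
rewrite !decode_cat => sc sc' cnt.
have := size_emitted (left_word z); have := size_emitted (right_word z).
move=> /andP[r1 r2] /andP[l1 l2].
by split; [apply: count_lag sc sc' _ _ _|apply: count_lag sc' sc _ _ _];
  try (by move=> u; case: (cnt u)); lia.
Qed.

(** The state of a prefix: the pending letter and the sortedness of each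
    component, the support of the first component, the difference of the
    multiplicities, and the shape of the padding.  A prefix whose differences
    exceed [update_lag] has no continuation, so all such prefixes can share
    the state in which [lag] is [None]. *)
Lemma update_regular : regular (d @` update_rel).
Proof.
pose pairs := seq (option 'I_n * option 'I_n).
pose cl (z : pairs) := emitted None (left_word z).
pose cr (z : pairs) := emitted None (right_word z).
pose alive z := [forall t,
  (count_mem t (cl z) <= count_mem t (cr z) + update_lag) &&
  (count_mem t (cr z) <= count_mem t (cl z) + update_lag)].
pose lag z : option {ffun cell n -> 'I_(2 * update_lag).+1} :=
  if alive z then
    Some [ffun t => inord (count_mem t (cr z) + update_lag - count_mem t (cl z))]
  else None.
pose f z := ((pending None (left_word z), sorted_state (@cell_le n) (cl z)),
  (pending None (right_word z), sorted_state (@cell_le n) (cr z)),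
  [set t in cl z]%SET, lag z, sorted_state e z, all (@nonempty_letter 'I_n) z).
apply: (nerode_regular (f := f)) => w w' s [] pl sl pr sr suppl lagw shw nzw.
case=> p Rp dp; exists (left_word (w' ++ s), right_word (w' ++ s)); last first.
  apply/esym/(pad_shape d_pad); rewrite -(sorted_state_cat _ shw).
  have /(pad_shape d_pad) : w ++ s = d (left_word (w ++ s), right_word (w ++ s)).
    by rewrite -dp (pad_left d_pad) (pad_right d_pad); case: p {Rp dp}.
  by rewrite !all_cat nzw.
have cnt t := update_prefix_count t Rp (esym dp).
have aw : alive w by apply/forallP => t; apply/andP; case: (cnt t).
have lagE t : count_mem t (cr w) + count_mem t (cl w') =
              count_mem t (cr w') + count_mem t (cl w).
  move: lagw; rewrite /lag aw; case: ifP => // /forallP/(_ t)/andP[h1 h2] [].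
  move/ffunP/(_ t); rewrite !ffunE => /(congr1 val) /=.
  have [] := cnt t; rewrite -/(cl w) -/(cr w) => h3 h4.
  move: (count_mem _ _) (count_mem _ _) (count_mem _ _) (count_mem _ _) h1 h2 h3 h4.
  by move=> r l r' l' h1 h2 h3 h4; rewrite !inordK; lia.
have [] := Rp; rewrite /update_rel /=.
rewrite -(pad_left d_pad p) -(pad_right d_pad p) dp !left_word_cat !right_word_cat.
rewrite !decode_cat -/(cl w) -/(cr w) -/(cl w') -/(cr w') -pl -pr.
rewrite (sorted_state_cat _ sl) (sorted_state_cat _ sr) => sc sc' pS; split=> //.
have -> : [set t in cl w' ++ decode_from (pending None (left_word w)) (left_word s)]%SET
   = [set t in cl w ++ decode_from (pending None (left_word w)) (left_word s)]%SET.
  apply/setP => t; rewrite !inE !mem_cat; congr (_ || _).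
  by have /setP/(_ t) := suppl; rewrite !inE.
move: pS; move: (add _) (del _) => a b.
move: (decode_from _ _) (decode_from _ _) => x y /permP pS.
rewrite /perm_eq; apply/allP => t _; apply/eqP; move/(_ (pred1 t)): pS.
have := lagE t; rewrite !count_cat /=.
move: (count_mem t (cl w)) (count_mem t (cr w)) => l r.
move: (count_mem t (cl w')) (count_mem t (cr w')) => l' r'.
move: (count_mem t a) (count_mem t b) (count_mem t x) (count_mem t y).
lia.
Qed.

End UpdateAutomaton.

(** * The biautomatic structure *)

Section ChineseAutomata.
Context (n : nat).
Local Notation g := (@chinese_gen n).
Local Notation eval := (word_eval g).

Lemma chinese_evalP (u v : seq 'I_n) :
  eval u = eval v <-> presentation_cong (@chinese_rel n) u v.
Proof.
rewrite /word_eval !prod_presented_gen.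
by split=> [/eqP/pi_presentedP|/pi_presentedP/eqP].
Qed.

Lemma chinese_gen_zyx (x y z : 'I_n) : x <= y -> y <= z ->
  (g z * g y * g x = g z * g x * g y)%g.
Proof.
move=> xy yz; have /chinese_evalP := cong_rel [::] [::] (chinese_rel1 xy yz).
by rewrite /word_eval !big_cons !big_nil !mulg1 !mulgA.
Qed.

Lemma chinese_gen_zxy (x y z : 'I_n) : x <= y -> y <= z ->
  (g z * g x * g y = g y * g z * g x)%g.
Proof.
move=> xy yz; have /chinese_evalP := cong_rel [::] [::] (chinese_rel2 xy yz).
by rewrite /word_eval !big_cons !big_nil !mulg1 !mulgA.
Qed.

Lemma chinese_lang_decode (w : seq 'I_n) :
  chinese_lang w <-> sorted (@cell_le n) (decode w).
Proof.
split=> [/chinese_langE[c [sc vc ->]]|sw]; first by rewrite cells_wordK.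
apply/chinese_langE; exists (decode w); split=> //; first exact: decode_valid.
by rewrite decodeK.
Qed.

Lemma chinese_lang_regular : regular (@chinese_lang n).
Proof.
apply: (nerode_regular (f := fun w =>
  (pending None w, sorted_state (@cell_le n) (emitted None w)))).
move=> w w' s [pw sw] /chinese_lang_decode; rewrite decode_cat => sc.
by apply/chinese_lang_decode; rewrite decode_cat -pw -(sorted_state_cat _ sw).
Qed.

Lemma eval_decode w : sorted (@cell_le n) (decode w) ->
  eval w = cells_eval g (decode w).
Proof.
move=> sw; rewrite /cells_eval sorted_sort ?sw //; last exact: cell_le_trans.
by rewrite -prod_cells_word decodeK.
Qed.

Lemma eval_normal_inj (u v : seq 'I_n) : chinese_lang u -> chinese_lang v ->
  eval u = eval v -> decode u = decode v.
Proof.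
move=> /chinese_lang_decode su /chinese_lang_decode sv /chinese_evalP uv.
by apply: normal_form_unique su _ sv _ _; rewrite ?decode_valid ?decodeK.
Qed.

Lemma normal_form_eval c : all (@cell_valid n) c ->
  exists2 w, chinese_lang w & eval w = cells_eval g c /\ perm_eq (decode w) c.
Proof.
move=> vc; pose s := sort (@cell_le n) c.
have ss : sorted (@cell_le n) s by exact: cell_sort_sorted.
have vs : all (@cell_valid n) s by rewrite all_sort.
exists (cells_word s); first by apply/chinese_langE; exists s.
by rewrite cells_wordK // perm_sort; split=> //; rewrite /word_eval prod_cells_word.
Qed.

(** By uniqueness of normal forms, F u = v in the monoid exactly when the
    cells of v are obtained from those of u by the update. *)
Lemma bounded_update_regular F :
  bounded_update g (@cell_valid n) F ->
  forall R : set (seq 'I_n * seq 'I_n),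
  (forall p, R p <-> [/\ chinese_lang p.1, chinese_lang p.2 &
                        F (eval p.1) = eval p.2]) ->
  forall d e, padding d e -> regular (d @` R).
Proof.
move=> /choice[add /choice[del upd]] R RE d e d_pad.
suff -> : R = update_rel add del by exact: update_regular d_pad.
apply/seteqP; split=> -[u v].
  move=> /RE[/= Lu Lv Fuv].
  have [su sv] := ((chinese_lang_decode _).1 Lu, (chinese_lang_decode _).1 Lv).
  split=> //=.
  have [c [vc pc]] := upd _ (decode u) (decode_valid u) erefl.
  have [w Lw [Ew pw]] := normal_form_eval vc.
  rewrite -eval_decode // Fuv -Ew => /(eval_normal_inj Lv Lw) ->.
  by apply: perm_trans pc; rewrite perm_cat2r.
move=> [/= su sv pv]; apply/RE.
have Lu : chinese_lang u by apply/chinese_lang_decode.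
have Lv : chinese_lang v by apply/chinese_lang_decode.
split=> //=; have [c [vc pc]] := upd _ (decode u) (decode_valid u) erefl.
rewrite -!eval_decode // => ->; rewrite (eval_decode sv); apply: cells_eval_perm.
by rewrite -(perm_cat2r (del [set t in decode u]%SET)) (perm_trans pc) // perm_sym.
Qed.

End ChineseAutomata.

Theorem theorem3p7 (n : nat) (hn : 1 <= n) :
  biautomatic_structure (@chinese_gen n) (@chinese_lang n).
Proof.
have [zyx zxy] := (@chinese_gen_zyx n, @chinese_gen_zxy n).
have onto (m : chinese_monoid n) :
    exists2 w, chinese_lang w & word_eval (@chinese_gen n) w = m.
  have -> : m = word_eval (@chinese_gen n) (repr m).
    by rewrite /word_eval prod_presented_gen reprK.
  have [c [vc Ec]] := normal_form_exists zyx zxy (repr m).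
  have [w Lw [Ew _]] := normal_form_eval vc; exists w => //.
  by rewrite Ew -Ec.
have right a d e : padding d e ->
    regular (d @` right_mul_rel (@chinese_gen n) (@chinese_lang n) a).
  case: a => [a|].
    apply: bounded_update_regular (right_mul_update zyx zxy a) _ _ _ _ => p.
    by rewrite /right_mul_rel /= /word_eval big_cat big_seq1.
  apply: bounded_update_regular (id_update _) _ _ _ _ => p.
  by rewrite /right_mul_rel /= cats0.
have left a d e : padding d e ->
    regular (d @` left_mul_rel (@chinese_gen n) (@chinese_lang n) a).
  case: a => [a|].
    apply: bounded_update_regular (left_mul_update zyx zxy a) _ _ _ _ => p.
    by rewrite /left_mul_rel /= /word_eval big_cons.
  by apply: bounded_update_regular (id_update _) _ _ _ _ => p.
split=> [m||||||] //.
- by have [w _ <-] := onto m; exists w.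
- exact: chinese_lang_regular.
- by move=> a; apply: right (padR_padding _).
- by move=> a; apply: left (padR_padding _).
- by move=> a; apply: right (padL_padding _).
- by move=> a; apply: left (padL_padding _).
Qed.
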